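(* Let $G$ be a groupoid and let $S$ be a nearly epsilon-strongly $G$-graded ring. The map $$\phi:\{G\text{-graded ideals of }S\}\to\{G\text{-invariant ideals of }\oplus_{e\in G_0}S_e\},\qquad \phi(I)=I\cap\oplus_{e\in G_0}S_e,$$ defines a bijection between the set of $G$-graded ideals of $S$ and the set of $G$-invariant ideals of $\oplus_{e\in G_0}S_e$. The inverse of $\phi$ is the map $$\psi:\{G\text{-invariant ideals of }\oplus_{e\in G_0}S_e\}\to\{G\text{-graded ideals of }S\},\qquad \psi(J)=SJS.$$
   Context: All rings are associative but not necessarily unital; ideals are two-sided. A groupoid $G$ is a small category in which every morphism is invertible; $G$ also denotes its set of morphisms. Objects are identified with identity morphisms, so the set of objects $G_0$ is a subset of $G$. The maps $s,r:G\to G_0$ are source and range; $gh$ is defined iff $s(g)=r(h)$. A ring $S$ is $G$-graded if there are additive subgroups $S_g$ ($g\in G$) with $S=\oplus_{g\in G}S_g$, $S_gS_h\subseteq S_{gh}$ if $s(g)=r(h)$, and $S_gS_h=\{0\}$ otherwise. For subsets $X,Y$ of a ring, $XY$ denotes the set of finite sums of products $xy$ with $x\in X$, $y\in Y$ (similarly for more factors). $\oplus_{e\in G_0}S_e$ is a subring of $S$. A ring $R$ is $s$-unital if for every $x\in R$ there are $a,b\in R$ with $ax=x=xb$. A $G$-graded ring $S$ is nearly epsilon-strongly $G$-graded if for each $g\in G$, $S_gS_{g^{-1}}$ is an $s$-unital ring and $S_gS_{g^{-1}}S_g=S_g$. An ideal $I$ of $S$ is a $G$-graded ideal if $I=\oplus_{g\in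 G}(I\cap S_g)$. A subset $J\subseteq S$ is $G$-invariant if $S_{g^{-1}}JS_g\subseteq J$ for every $g\in G$. *)

(* Defs.v *)
From HB Require Import structures.
From mathcomp Require Import all_boot all_algebra.
From mathcomp Require Import boolp classical_sets functions.

Set Implicit Arguments.
Unset Strict Implicit.
Unset Printing Implicit Defensive.

Import GRing.Theory.
Local Open Scope classical_set_scope.
Local Open Scope ring_scope.

(* A groupoid presented by its set of morphisms, objects being identified with
   identity morphisms.  The product [gcomp g h] of g and h is defined iff
   [gsrc g = gtgt h]; the total function [gcomp] takes arbitrary values on the
   other pairs, and no axiom mentions them. *)
HB.mixin Record isGroupoid G of Choice G := {
  gsrc : G -> G;
  gtgt : G -> G;
  gcomp : G -> G -> G;
  ginv : G -> G;
  gsrc_src : forall g, gsrc (gsrc g) = gsrc g;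
  gtgt_src : forall g, gtgt (gsrc g) = gsrc g;
  gsrc_tgt : forall g, gsrc (gtgt g) = gtgt g;
  gtgt_tgt : forall g, gtgt (gtgt g) = gtgt g;
  gsrc_comp : forall g h, gsrc g = gtgt h -> gsrc (gcomp g h) = gsrc h;
  gtgt_comp : forall g h, gsrc g = gtgt h -> gtgt (gcomp g h) = gtgt g;
  gcompA : forall g h k, gsrc g = gtgt h -> gsrc h = gtgt k ->
    gcomp g (gcomp h k) = gcomp (gcomp g h) k;
  gcomp_src : forall g, gcomp g (gsrc g) = g;
  gcomp_tgt : forall g, gcomp (gtgt g) g = g;
  gsrc_inv : forall g, gsrc (ginv g) = gtgt g;
  gtgt_inv : forall g, gtgt (ginv g) = gsrc g;
  gcompVg : forall g, gcomp (ginv g) g = gsrc g;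
  gcompgV : forall g, gcomp g (ginv g) = gtgt g
}.

#[short(type="groupoidType")]
HB.structure Definition Groupoid := {G of isGroupoid G & Choice G}.

Definition gobjects (G : groupoidType) : set G := range (@gsrc G).

(* Associative, not necessarily unital, rings; the library's rings all have
   a unit. *)
HB.mixin Record Zmodule_isRng R of GRing.Zmodule R := {
  rmul : R -> R -> R;
  rmulA : associative rmul;
  rmulDl : left_distributive rmul +%R;
  rmulDr : right_distributive rmul +%R
}.

#[short(type="rngType")]
HB.structure Definition Rng := {R of Zmodule_isRng R & GRing.Zmodule R}.

Section Subsets.
Variable R : rngType.
Implicit Types (X Y Z T I : set R).

Definition finite_sums X : set R :=
  [set x | exists2 xs : seq R, {in xs, forall u, X u} & x = \sum_(u <- xs) u].

Definition pointwise_mul X Y : set R := [set rmul x y | x in X & y in Y].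

Definition prod2 X Y : set R := finite_sums (pointwise_mul X Y).

Definition prod3 X Y Z : set R :=
  finite_sums (pointwise_mul (pointwise_mul X Y) Z).

Definition is_subgroup X : Prop := zmod_closed (mem X).

Definition is_subring T : Prop :=
  is_subgroup T /\ (forall x y, T x -> T y -> T (rmul x y)).

Definition is_ideal T I : Prop :=
  [/\ I `<=` T, is_subgroup I &
      forall a x, T a -> I x -> I (rmul a x) /\ I (rmul x a)].

Definition s_unital_ring T : Prop :=
  is_subring T /\
  (forall x, T x -> exists a b, [/\ T a, T b, rmul a x = x & rmul x b = x]).

End Subsets.

Section DirectSums.
Variables (K : choiceType) (R : zmodType).

Definition family_sum (D : set K) (A : K -> set R) : set R :=
  [set x | exists (ks : seq K) (f : K -> R),
     [/\ uniq ks, {in ks, forall k, D k /\ A k (f k)} &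
         x = \sum_(k <- ks) f k]].

Definition independent (D : set K) (A : K -> set R) : Prop :=
  forall (ks : seq K) (f : K -> R),
    uniq ks -> {in ks, forall k, D k /\ A k (f k)} ->
    \sum_(k <- ks) f k = 0 -> {in ks, forall k, f k = 0}.

Definition is_direct_sum (D : set K) (A : K -> set R) (B : set R) : Prop :=
  B = family_sum D A /\ independent D A.

End DirectSums.

Section Graded.
Variables (G : groupoidType) (S : rngType) (gr : G -> set S).

Definition is_graded : Prop :=
  [/\ forall g, is_subgroup (gr g),
      is_direct_sum setT gr setT,
      forall g h, gsrc g = gtgt h -> prod2 (gr g) (gr h) `<=` gr (gcomp g h) &
      forall g h, gsrc g <> gtgt h -> prod2 (gr g) (gr h) = [set 0]].

Definition nearly_epsilon_strongly_graded : Prop :=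
  is_graded /\
  (forall g, s_unital_ring (prod2 (gr g) (gr (ginv g))) /\
             prod3 (gr g) (gr (ginv g)) (gr g) = gr g).

Definition object_subring : set S := family_sum (@gobjects G) gr.

Definition graded_ideal (I : set S) : Prop :=
  is_ideal setT I /\ is_direct_sum setT (fun g => I `&` gr g) I.

Definition invariant (J : set S) : Prop :=
  forall g, prod3 (gr (ginv g)) J (gr g) `<=` J.

Definition invariant_ideal (J : set S) : Prop :=
  is_ideal object_subring J /\ invariant J.

Definition phi (I : set S) : set S := I `&` object_subring.

Definition psi (J : set S) : set S := prod3 setT J setT.

End Graded.

(* Main.v *)
Require Import Defs.
From mathcomp Require Import all_boot all_algebra.
From mathcomp Require Import boolp classical_sets functions.

(** Write [S_0] for the sum of the [S_e] over the objects [e].  Near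
    epsilon-strongness gives every homogeneous [x] in [S_g] a left unit in
    [S_g S_{g^-1}] and a right unit in [S_{g^-1} S_g] ([homogeneous_left_unit],
    [homogeneous_right_unit]): [x] is a finite sum of products [(a b) c] with
    [a b] in the s-unital ring [S_g S_{g^-1}], and in an s-unital ring finitely
    many elements have a common unit ([common_left_unit],
    [sum_multiples_left_unit]).

    These units prove the two inclusions that are not formal.  If [I] is a
    graded ideal and [x] lies in its component of degree [g], write a left unit
    of [x] as the sum of the [a b], and let [u] be a right unit: then [x] is the
    sum of the [a (b x) u], and every [b x] lies in [I] and has the identity
    degree [g^-1 g], so [x] lies in [S (phi I) S].  If [J] is an ideal of [S_0],
    the unit of the component [j_e] of an element [j] of [J] kills the other
    components, so that [j_e] is a product in [S_0] with the factor [j], hence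
    [J] contains its own components; being fixed by units on both sides,
    these lie in [S J S].

    Both the gradedness of [S J S] and the inclusion of [phi (psi J)] in [J] come
    from one decomposition ([psi_homogeneous_sum]).  By bilinearity [S J S] is
    spanned by the [a j b] with [a] in [S_g] and [b] in [S_h].  As [S_g S_0] lies
    in [S_g], such a product is zero or homogeneous of degree [g h]; and if [g h]
    is an object then [h = g^-1], so that the product lies in [J] by invariance.
    An element of [S J S] is thus a sum of homogeneous elements of [S J S] whose
    components at objects lie in [J].  When the element is in [S_0], its
    components at the other degrees vanish because the sum is direct. *)

Set Implicit Arguments.
Unset Strict Implicit.
Unset Printing Implicit Defensive.

Import GRing.Theory.
Local Open Scope classical_set_scope.
Local Open Scope ring_scope.

(** * Groupoids *)

Section Groupoid.
Variable G : groupoidType.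
Implicit Types g h e : G.

Lemma ginvK g : ginv (ginv g) = g.
Proof.
rewrite -[LHS]gcomp_src gsrc_inv gtgt_inv -gcompVg gcompA ?gsrc_inv //.
by rewrite gcompVg gsrc_inv gcomp_tgt.
Qed.

Lemma gobject_src e : gobjects e -> gsrc e = e.
Proof. by case=> g _ <-; rewrite gsrc_src. Qed.

Lemma gobject_tgt e : gobjects e -> gtgt e = e.
Proof. by case=> g _ <-; rewrite gtgt_src. Qed.

Lemma gobjects_src g : gobjects (gsrc g).
Proof. by exists g. Qed.

Lemma gcomp_object_inv g h :
  gsrc g = gtgt h -> gobjects (gcomp g h) -> h = ginv g.
Proof.
move=> gh ob.
have gh_tgt : gcomp g h = gtgt g by rewrite -(gobject_tgt ob) gtgt_comp.
rewrite -[RHS]gcomp_src gsrc_inv -gh_tgt gcompA ?gsrc_inv //.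
by rewrite gcompVg gh gcomp_tgt.
Qed.

End Groupoid.

(** * Subgroups, finite sums and direct sums *)

Section Sums.
Variable V : zmodType.
Implicit Types X H : set V.

Definition add_closed H := H 0 /\ forall x y, H x -> H y -> H (x + y).

Lemma zmod_closedP H :
  zmod_closed (mem H) <-> H 0 /\ forall x y, H x -> H y -> H (x - y).
Proof.
split=> [[H0 HB]|[H0 HB]].
  by split=> [|x y Hx Hy]; apply: set_mem; [exact: H0 | apply: HB; exact: mem_set].
split=> [|x y Hx Hy]; apply: mem_set => //.
by apply: HB; apply: set_mem.
Qed.

Lemma zmod_add_closed H : zmod_closed (mem H) -> add_closed H.
Proof.
move=> /zmod_closedP [H0 HB]; split=> // x y Hx Hy.
by rewrite -[y]opprK; apply: (HB) => //; rewrite -sub0r; apply: HB.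
Qed.

Lemma add_closed_sum H (I : eqType) (ks : seq I) (f : I -> V) :
  add_closed H -> {in ks, forall k, H (f k)} -> H (\sum_(k <- ks) f k).
Proof.
move=> [H0 HD] Hf; rewrite big_seq.
by elim/big_ind: _.
Qed.

Variable K : choiceType.
Implicit Types (D : set K) (A : K -> set V).

Lemma sum_extend (ks ls : seq K) (f : K -> V) :
  uniq ks -> uniq ls -> {subset ks <= ls} ->
  \sum_(k <- ls) (if k \in ks then f k else 0) = \sum_(k <- ks) f k.
Proof.
move=> uk ul kl; rewrite -big_mkcond -big_filter; apply: perm_big.
apply: uniq_perm; rewrite ?filter_uniq // => k; rewrite mem_filter.
by case: (boolP (k \in ks)) => // /kl ->.
Qed.

Lemma family_sum_sub D A H :
  add_closed H -> (forall k, D k -> A k `<=` H) -> family_sum D A `<=` H.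
Proof.
move=> addH AH x [ks [f [_ fA ->]]]; apply: add_closed_sum => // k /fA [Dk].
exact: AH.
Qed.

Lemma family_sum_mem D A k x : D k -> A k x -> family_sum D A x.
Proof.
move=> Dk Ax; exists [:: k], (fun=> x); split=> //; last by rewrite big_seq1.
by move=> l; rewrite inE => /eqP ->.
Qed.

Lemma family_sumS D E A B :
  (forall k, D k -> E k /\ A k `<=` B k) -> family_sum D A `<=` family_sum E B.
Proof.
move=> sub x [ks [f [uk fA ->]]]; exists ks, f; split=> // k /fA [Dk Afk].
by have [Ek AB] := sub k Dk; split=> //; apply: AB.
Qed.

Lemma family_sum_zmod D A :
  (forall k, D k -> zmod_closed (mem (A k))) ->
  zmod_closed (mem (family_sum D A)).
Proof.
move=> subA; apply/zmod_closedP; split.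
  by exists [::], (fun=> 0); split; rewrite ?big_nil.
move=> _ _ [ks [f [uk fA ->]]] [ls [h [ul hA ->]]].
exists (undup (ks ++ ls)), (fun k =>
  (if k \in ks then f k else 0) - (if k \in ls then h k else 0)).
split; first exact: undup_uniq.
  move=> k; rewrite mem_undup mem_cat => kin.
  have Dk : D k by case/orP: kin => [/fA|/hA] [].
  have /zmod_closedP [A0 AB] := subA k Dk.
  by split=> //; apply: AB; [case: ifP => // /fA [] | case: ifP => // /hA []].
rewrite sumrB !sum_extend ?undup_uniq // => k kin;
  by rewrite mem_undup mem_cat kin ?orbT.
Qed.

(** Uniqueness of components has to compare sums over two different finite sets
    of indices: an element of [S J S] in [S_0] has one expression from [S J S],
    whose indices are arbitrary, and another one indexed by objects.  Both are
    extended by zero to the union of the two index sets. *)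
Lemma independent_component0 D A (ks ls : seq K) (f h : K -> V) :
  (forall k, D k -> zmod_closed (mem (A k))) -> independent D A ->
  uniq ks -> {in ks, forall k, D k /\ A k (f k)} ->
  uniq ls -> {in ls, forall k, D k /\ A k (h k)} ->
  \sum_(k <- ks) f k = \sum_(k <- ls) h k ->
  {in ks, forall k, k \notin ls -> f k = 0}.
Proof.
move=> subA indA uk fA ul hA eq_sum k kks kls.
pose F k := (if k \in ks then f k else 0) - (if k \in ls then h k else 0).
have <- : F k = f k by rewrite /F kks (negPf kls) subr0.
apply: (indA (undup (ks ++ ls))); first exact: undup_uniq.
- move=> l; rewrite mem_undup mem_cat => lin.
  have Dl : D l by case/orP: lin => [/fA|/hA] [].
  have /zmod_closedP [A0 AB] := subA l Dl.
  by split=> //; apply: AB; [case: ifP => // /fA [] | case: ifP => // /hA []].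
- rewrite sumrB !sum_extend ?undup_uniq ?eq_sum ?subrr // => l lin;
    by rewrite mem_undup mem_cat lin ?orbT.
- by rewrite mem_undup mem_cat kks.
Qed.

Lemma independentS D A B :
  (forall k, B k `<=` A k) -> independent D A -> independent D B.
Proof.
move=> BA indA ks f uk fB; apply: indA => // k /fB [Dk Bk].
by split=> //; apply: BA.
Qed.

End Sums.

(** * Rings without unit *)

Section Ring.
Variable R : rngType.
Implicit Types (x y z : R) (X Y H T : set R).

Lemma rmul0l x : rmul 0 x = 0.
Proof. by apply: (addrI (rmul 0 x)); rewrite -rmulDl !addr0. Qed.

Lemma rmul0r x : rmul x 0 = 0.
Proof. by apply: (addrI (rmul x 0)); rewrite -rmulDr !addr0. Qed.

Lemma rmulNl x y : rmul (- x) y = - rmul x y.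
Proof. by apply: (addrI (rmul x y)); rewrite -rmulDl !subrr rmul0l. Qed.

Lemma rmul_suml (I : Type) (ks : seq I) (f : I -> R) y :
  rmul (\sum_(k <- ks) f k) y = \sum_(k <- ks) rmul (f k) y.
Proof. by apply: (big_morph (rmul^~ y) _ (rmul0l y)) => u v; exact: rmulDl. Qed.

Lemma rmul_sumr (I : Type) (ks : seq I) (f : I -> R) y :
  rmul y (\sum_(k <- ks) f k) = \sum_(k <- ks) rmul y (f k).
Proof. by apply: (big_morph (rmul y) _ (rmul0r y)) => u v; exact: rmulDr. Qed.

Lemma finite_sums_sub X H : add_closed H -> X `<=` H -> finite_sums X `<=` H.
Proof. by move=> addH XH _ [xs Xxs ->]; apply: add_closed_sum => // u /Xxs /XH. Qed.

Lemma finite_sums_mem X : X `<=` finite_sums X.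
Proof.
move=> x Xx; exists [:: x]; last by rewrite big_seq1.
by move=> y; rewrite inE => /eqP ->.
Qed.

Lemma finite_sums_add_closed X : add_closed (finite_sums X).
Proof.
split; first by exists [::]; rewrite ?big_nil.
move=> _ _ [xs Xxs ->] [ys Xys ->]; exists (xs ++ ys); last by rewrite big_cat.
by move=> u; rewrite mem_cat => /orP [/Xxs|/Xys].
Qed.

Lemma finite_sums_zmod X :
  (forall x, X x -> X (- x)) -> zmod_closed (mem (finite_sums X)).
Proof.
move=> XN; apply/zmod_closedP; have [F0 FD] := finite_sums_add_closed X.
split=> // x _ Fx [ys Xys ->]; apply: FD => //; rewrite -sumrN.
apply: add_closed_sum; first exact: finite_sums_add_closed.
by move=> y /Xys /XN /finite_sums_mem.
Qed.

Lemma prod2_mem X Y x y : X x -> Y y -> prod2 X Y (rmul x y).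
Proof. by move=> Xx Yy; apply: finite_sums_mem; exists x => //; exists y. Qed.

Lemma prod3_mem X Y T x y z :
  X x -> Y y -> T z -> prod3 X Y T (rmul (rmul x y) z).
Proof.
move=> Xx Yy Tz; apply: finite_sums_mem.
by exists (rmul x y); [exists x => //; exists y | exists z].
Qed.

Lemma prod3_sub X Y T H : add_closed H ->
  (forall x y z, X x -> Y y -> T z -> H (rmul (rmul x y) z)) ->
  prod3 X Y T `<=` H.
Proof.
move=> addH XYTH; apply: finite_sums_sub => //.
by move=> _ [_ [x Xx [y Yy <-]] [z Tz <-]]; apply: XYTH.
Qed.

Lemma prod3T_ideal Y : is_ideal setT (prod3 setT Y setT).
Proof.
split=> //.
  apply: finite_sums_zmod => _ [_ [x _ [y Yy <-]] [z _ <-]].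
  exists (rmul (- x) y); first by exists (- x) => //; exists y.
  by exists z => //; rewrite !rmulNl.
have [P0 PD] := finite_sums_add_closed
  (pointwise_mul (pointwise_mul setT Y) [set: R]).
move=> a x _; pose H u := prod3 setT Y setT (rmul a u) /\ prod3 setT Y setT (rmul u a).
apply: (@prod3_sub _ _ _ H) => [|u y v _ Yy _].
  split=> [|u v [? ?] [? ?]]; first by rewrite /H rmul0l rmul0r.
  by rewrite /H rmulDl rmulDr; split; apply: PD.
by split; rewrite -?rmulA 1?[rmul a _]rmulA 1?[rmul _ (rmul y _)]rmulA;
  apply: prod3_mem.
Qed.

End Ring.

(** Tominaga's argument.  If [e] fixes the elements found so far and [f] fixes
    [x - e x], then [e + f - f e], that is [1 - (1 - f)(1 - e)] in a unital
    extension, fixes them all.  The multiplication is a parameter so that the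
    statement also applies to the opposite one. *)
Lemma common_left_unit (V : zmodType) (m : V -> V -> V) (T : set V) :
  associative m -> left_distributive m +%R -> right_distributive m +%R ->
  zmod_closed (mem T) -> (forall x y, T x -> T y -> T (m x y)) ->
  (forall x, T x -> exists2 e, T e & m e x = x) ->
  forall xs : seq V, {in xs, forall x, T x} ->
    exists2 e, T e & {in xs, forall x, m e x = x}.
Proof.
move=> mA mDl mDr subT TM unitT; have [_ TD] := zmod_add_closed subT.
have /zmod_closedP [T0 TB] := subT.
have mBl x y z : m (x - y) z = m x z - m y z.
  by apply: (addIr (m y z)); rewrite -mDl !subrK.
have mBr x y z : m x (y - z) = m x y - m x z.
  by apply: (addIr (m x z)); rewrite -mDr !subrK.
elim=> [|x xs IH] Txs; first by exists 0.
have Tx : T x by apply: Txs; rewrite mem_head.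
have [|e Te exs] := IH; first by move=> y yxs; apply: Txs; rewrite inE yxs orbT.
have [|f Tf fx] := unitT (x - m e x); first by apply: TB => //; apply: TM.
exists (e + f - m f e); first by apply: TB; [exact: TD | exact: TM].
have efE y : m (e + f - m f e) y = m e y + m f (y - m e y).
  by rewrite mBl mDl mBr mA addrA.
move=> y; rewrite inE efE => /predU1P [->|/exs ->]; first by rewrite fx addrC subrK.
by rewrite mBr !subrr addr0.
Qed.

(** A left unit of [p] fixes [p c] for every [c], so that a common left unit of
    the factors [p] fixes the sum of the products. *)
Lemma sum_multiples_left_unit (V : zmodType) (m : V -> V -> V) (T : set V) :
  associative m -> left_distributive m +%R -> right_distributive m +%R ->
  zmod_closed (mem T) -> (forall x y, T x -> T y -> T (m x y)) ->
  (forall x, T x -> exists2 e, T e & m e x = x) ->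
  forall xs : seq V, {in xs, forall x, exists2 p, T p & exists c, x = m p c} ->
    exists2 e, T e & m e (\sum_(x <- xs) x) = \sum_(x <- xs) x.
Proof.
move=> mA mDl mDr subT TM unitT xs Txs.
have [ps Tps psE] : exists2 ps : seq V, {in ps, forall p, T p} & forall e,
    {in ps, forall p, m e p = p} -> {in xs, forall x, m e x = x}.
  elim: xs Txs => [|x xs IH] Txs; first by exists [::].
  have [|ps Tps psE] := IH; first by move=> y yxs; apply: Txs; rewrite inE yxs orbT.
  have [|p Tp [c xE]] := Txs x; first by rewrite mem_head.
  exists (p :: ps) => [q|e eps y]; first by rewrite inE => /predU1P [->|/Tps].
  rewrite inE => /predU1P [->|]; first by rewrite xE mA eps ?mem_head.
  by apply: psE => q qps; apply: eps; rewrite inE qps orbT.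
have [e Te eps] := common_left_unit mA mDl mDr subT TM unitT Tps.
exists e => //; have me0 : m e 0 = 0.
  by apply: (addrI (m e 0)); rewrite -mDr !addr0.
rewrite (big_morph (m e) (mDr e) me0).
by apply: eq_big_seq; exact: psE.
Qed.

(** * Graded rings *)

Section Graded.
Variables (G : groupoidType) (S : rngType) (gr : G -> set S).
Hypothesis grS : is_graded gr.
Implicit Types (g h e : G) (I J : set S).

Let S0 := object_subring gr.

Lemma gr_zmod g : zmod_closed (mem (gr g)).
Proof. by case: grS => subgr _ _ _; exact: subgr. Qed.

Lemma gr_independent : independent setT gr.
Proof. by case: grS => _ [_ ind] _ _. Qed.

Lemma gr_span x : family_sum setT gr x.
Proof. by case: grS => _ [<- _] _ _. Qed.

Lemma gr_mul g h a b :
  gsrc g = gtgt h -> gr g a -> gr h b -> gr (gcomp g h) (rmul a b).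
Proof. by case: grS => _ _ grM _ /grM grgh ga hb; apply: grgh; exact: prod2_mem. Qed.

Lemma gr_mul0 g h a b : gsrc g <> gtgt h -> gr g a -> gr h b -> rmul a b = 0.
Proof.
by case: grS => _ _ _ gr0 /gr0 gh0 ga hb; have := prod2_mem ga hb; rewrite gh0.
Qed.

Lemma object_subring_zmod : zmod_closed (mem S0).
Proof. by apply: family_sum_zmod => k _; exact: gr_zmod. Qed.

Lemma object_mul_gr g x a : S0 x -> gr g a -> gr g (rmul x a).
Proof.
move=> Sx ga; have [gr0 grD] := zmod_add_closed (gr_zmod g); move: x Sx.
apply: (@family_sum_sub _ _ _ _ (fun x => gr g (rmul x a))) => [|e oe x ex].
  split=> [|x y gx gy]; first by rewrite rmul0l.
  by rewrite rmulDl; apply: grD.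
have [eg|ne] := eqVneq (gsrc e) (gtgt g).
  by have := gr_mul eg ex ga; rewrite -(gobject_src oe) eg gcomp_tgt.
by rewrite (gr_mul0 _ ex ga) //; exact/eqP.
Qed.

Lemma gr_mul_object g x a : gr g a -> S0 x -> gr g (rmul a x).
Proof.
move=> ga Sx; have [gr0 grD] := zmod_add_closed (gr_zmod g); move: x Sx.
apply: (@family_sum_sub _ _ _ _ (fun x => gr g (rmul a x))) => [|e oe x ex].
  split=> [|x y gx gy]; first by rewrite rmul0r.
  by rewrite rmulDr; apply: grD.
have [ge|ne] := eqVneq (gsrc g) (gtgt e).
  by have := gr_mul ge ga ex; rewrite -(gobject_tgt oe) -ge gcomp_src.
by rewrite (gr_mul0 _ ga ex) //; exact/eqP.
Qed.

Lemma object_subring_mul x y : S0 x -> S0 y -> S0 (rmul x y).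
Proof.
move=> Sx; have [S00 S0D] := zmod_add_closed object_subring_zmod; move: y.
apply: (@family_sum_sub _ _ _ _ (fun y => S0 (rmul x y))) => [|e oe y ey].
  split=> [|y z ? ?]; first by rewrite rmul0r.
  by rewrite rmulDr; apply: S0D.
by apply: (family_sum_mem oe); apply: object_mul_gr.
Qed.

Lemma gr_inv_mul g a b : gr (ginv g) a -> gr g b -> gr (gsrc g) (rmul a b).
Proof. by move=> ga gb; rewrite -gcompVg; apply: gr_mul; rewrite ?gsrc_inv. Qed.

Lemma phi_invariant_ideal I : graded_ideal gr I -> invariant_ideal gr (phi gr I).
Proof.
move=> [[_ subI IM] _].
have /zmod_closedP [I0 IB] := subI.
have /zmod_closedP [S00 S0B] := object_subring_zmod.
have subphi : zmod_closed (mem (phi gr I)).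
  apply/zmod_closedP; split=> // x y [Ix Sx] [Iy Sy].
  by split; [apply: IB | apply: S0B].
split.
  split=> [x []||a x Sa [Ix Sx]] //.
  have [Iax Ixa] := IM a x Logic.I Ix.
  by split; split=> //; apply: object_subring_mul.
move=> g; apply: prod3_sub; first exact: zmod_add_closed.
move=> a x b ga [Ix Sx] gb; split.
  by apply: (IM b _ _ _).2 => //; apply: (IM a _ _ _).1.
apply: (family_sum_mem (gobjects_src g)); apply: gr_inv_mul => //.
exact: gr_mul_object.
Qed.

(** One family serves two purposes: membership in [psi J] makes [psi J] graded,
    and the condition at objects bounds [psi J] in [S_0] by [J]. *)
Definition psi_component J g : set S :=
  [set y | [/\ psi J y, gr g y & gobjects g -> J y]].

Lemma psi_component_zmod J g :
  zmod_closed (mem J) -> zmod_closed (mem (psi_component J g)).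
Proof.
move=> /zmod_closedP [J0 JB]; have /zmod_closedP [g0 gB] := gr_zmod g.
have [_ /zmod_closedP [P0 PB] _] := prod3T_ideal J.
apply/zmod_closedP; split=> // x y [Px gx ox] [Py gy oy].
by split=> [||/[dup] /ox Jx /oy Jy]; [apply: PB | apply: gB | apply: JB].
Qed.

(** By bilinearity it suffices to treat [s j t] with [s], [t] homogeneous.  The
    factor [j] is kept whole: right multiplication by [S_0] preserves the degree
    of [s].  If the degree [g h] is an object, then [h] is the inverse of
    [g], and invariance applies. *)
Lemma psi_homogeneous_sum J :
  invariant_ideal gr J -> psi J `<=` family_sum setT (psi_component J).
Proof.
move=> [[JS0 subJ _] invJ].
have subA k : zmod_closed (mem (psi_component J k)) by apply: psi_component_zmod.
have addF := zmod_add_closed (family_sum_zmod (fun k (_ : setT k) => subA k)).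
have [F0 FD] := addF.
apply: prod3_sub => // s j t _ Jj _.
move: s (gr_span s); apply: (@family_sum_sub _ _ _ _
    (fun s => family_sum setT (psi_component J) (rmul (rmul s j) t))).
  split=> [|x y ? ?]; first by rewrite !rmul0l.
  by rewrite !rmulDl; apply: FD.
move=> g _ s gs; move: t (gr_span t); apply: (@family_sum_sub _ _ _ _
    (fun t => family_sum setT (psi_component J) (rmul (rmul s j) t))).
  split=> [|x y ? ?]; first by rewrite rmul0r.
  by rewrite rmulDr; apply: FD.
move=> h _ t ht; have gsj : gr g (rmul s j) by apply: gr_mul_object => //; apply: JS0.
have [gh|ngh] := eqVneq (gsrc g) (gtgt h); last first.
  by rewrite (gr_mul0 _ gsj ht) //; exact/eqP.
apply: (@family_sum_mem _ _ _ _ (gcomp g h)) => //; split.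
- exact: prod3_mem.
- exact: gr_mul.
- move=> /(gcomp_object_inv gh) eh; apply: (invJ (ginv g)).
  by rewrite ginvK -eh; apply: prod3_mem.
Qed.

Lemma psi_graded_ideal J : invariant_ideal gr J -> graded_ideal gr (psi J).
Proof.
move=> invJ; have idP := prod3T_ideal J; have [_ subP _] := idP.
split=> //; split.
  rewrite eqEsubset; split.
    move=> x /(psi_homogeneous_sum invJ); apply: family_sumS => k _.
    by split=> // y [].
  by apply: family_sum_sub => [|k _ y []]; first exact: zmod_add_closed.
by apply: independentS gr_independent => k y [].
Qed.

(** The components of [x] at objects lie in [J] by the choice of the family, and
    those at other degrees vanish as [x] is also a sum over objects. *)
Lemma phi_psi_sub J : invariant_ideal gr J -> phi gr (psi J) `<=` J.
Proof.
move=> invJ; have [[_ subJ _] _] := invJ.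
move=> x [/(psi_homogeneous_sum invJ) [ks [f [uk fA xf]]] [ls [h [ul hA xh]]]].
have addJ := zmod_add_closed subJ.
rewrite xf; apply: add_closed_sum => // k kks.
have [_ [_ _ oJ]] := fA k kks.
have [kls|kls] := boolP (k \in ls); first by apply: oJ; case: (hA k kls).
rewrite (@independent_component0 _ _ setT gr ks ls f h) //.
- by case: addJ.
- by move=> l _; apply: gr_zmod.
- exact: gr_independent.
- by move=> l /fA [_ []].
- by move=> l /hA [].
- by rewrite -xf.
Qed.

End Graded.

(** * Local units *)

Section Units.
Variables (G : groupoidType) (S : rngType) (gr : G -> set S).
Hypothesis nearS : nearly_epsilon_strongly_graded gr.
Implicit Types (g h e : G) (I J : set S).

Let grS : is_graded gr := nearS.1.

(** [S_g = (S_g S_{g^-1}) S_g] exhibits [x] as a sum of left multiples of elements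
    of an s-unital ring. *)
Lemma homogeneous_left_unit g x :
  gr g x -> exists2 e, prod2 (gr g) (gr (ginv g)) e & rmul e x = x.
Proof.
case: nearS => _ /(_ g) [[[subT TM] unitT] gE].
rewrite -{1}gE => -[xs Xxs ->].
apply: (sum_multiples_left_unit (@rmulA S) (@rmulDl S) (@rmulDr S)) => //.
  by move=> y /unitT [a [b [Pa _ ay _]]]; exists a.
move=> _ /Xxs [_ [a ga [b gb <-]] [c _ <-]].
by exists (rmul a b); [exact: prod2_mem | exists c].
Qed.

(** The mirror image: [S_g = S_g (S_{g^-1} S_g)], where [S_{g^-1} S_g] is the
    s-unital ring attached to [g^-1], and the multiplication is reversed. *)
Lemma homogeneous_right_unit g x :
  gr g x -> exists2 e, prod2 (gr (ginv g)) (gr g) e & rmul x e = x.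
Proof.
case: nearS => _ near; have [_ gE] := near g.
rewrite -{1}gE => -[xs Xxs ->].
have := near (ginv g); rewrite ginvK => -[[[subT TM] unitT] _].
apply: (@sum_multiples_left_unit S (fun y z => rmul z y)) => //.
- by move=> a b c; rewrite rmulA.
- by move=> a b c; rewrite rmulDr.
- by move=> a b c; rewrite rmulDl.
- by move=> a b Pa Pb; apply: TM.
- by move=> y /unitT [a [b [_ Pb _ yb]]]; exists b.
move=> _ /Xxs [_ [a ga [b gb <-]] [c gc <-]].
by exists (rmul b c); [exact: prod2_mem | exists a; rewrite rmulA].
Qed.

(** A homogeneous [x] in [I] is moved into [S_0] by the right factors [b] of a
    left unit, and a right unit supplies the missing last factor. *)
Lemma psi_phi I : graded_ideal gr I -> psi (phi gr I) = I.
Proof.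
move=> [[_ subI IM] [IE _]]; rewrite eqEsubset; split.
  apply: prod3_sub; first exact: zmod_add_closed.
  by move=> a x b _ [Ix _] _; apply: (IM b _ _ _).2 => //; apply: (IM a _ _ _).1.
have addP := finite_sums_add_closed
  (pointwise_mul (pointwise_mul setT (phi gr I)) [set: S]).
rewrite {1}IE; apply: family_sum_sub => // g _ x [Ix gx].
have [_ [xs Xxs ->] ex] := homogeneous_left_unit gx.
have [u _ xu] := homogeneous_right_unit gx.
rewrite -ex rmul_suml; apply: add_closed_sum => // p /Xxs [a ga [b gb <-]].
have -> : rmul (rmul a b) x = rmul (rmul a (rmul b x)) u by rewrite -!rmulA xu.
apply: prod3_mem => //.
split; first exact: (IM b x Logic.I Ix).1.
by apply: (family_sum_mem (gobjects_src g)); apply: gr_inv_mul.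
Qed.

(** Each component of [j] is both a multiple of [j] by a local unit, hence in [J],
    and fixed by local units on both sides, hence in [S J S]. *)
Lemma sub_phi_psi J : invariant_ideal gr J -> J `<=` phi gr (psi J).
Proof.
move=> [[JS0 subJ JM] _] j Jj; split; last exact: JS0.
have addP := finite_sums_add_closed
  (pointwise_mul (pointwise_mul setT J) [set: S]).
have [es [f [ue fA jE]]] := JS0 _ Jj; rewrite jE.
apply: add_closed_sum => // e ein; have [oe efe] := fA e ein.
have [u Pu uf] := homogeneous_left_unit efe.
have [v _ fv] := homogeneous_right_unit efe.
have eu : gr e u.
  move: u Pu {uf}; apply: finite_sums_sub; first exact: zmod_add_closed (gr_zmod grS e).
  move=> _ [a ea [b eb <-]]; rewrite -{1}(gobject_tgt oe) -gcompgV.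
  by apply: gr_mul; rewrite ?gtgt_inv.
(* The left unit [u] of the component of [j] at [e] kills the others. *)
have uj : rmul u j = f e.
  rewrite jE rmul_sumr (bigD1_seq e) //= uf big_seq_cond big1 ?addr0 // => k.
  move=> /andP [kin ne]; have [ok kfk] := fA k kin.
  apply: (gr_mul0 grS _ eu kfk); rewrite (gobject_src oe) (gobject_tgt ok) => ek.
  by rewrite ek eqxx in ne.
rewrite -fv -uf; apply: prod3_mem => //; rewrite -uj.
by apply: (JM u j _ _).1 => //; apply: (family_sum_mem oe).
Qed.

End Units.

(** * The correspondence *)

Theorem theorem3p15 (G : groupoidType) (S : rngType) (gr : G -> set S) :
  nearly_epsilon_strongly_graded gr ->
  [/\ set_bij [set I | graded_ideal gr I] [set J | invariant_ideal gr J] (phi gr),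
      set_fun [set J | invariant_ideal gr J] [set I | graded_ideal gr I] (@psi S),
      {in [set I | graded_ideal gr I], cancel (phi gr) (@psi S)} &
      {in [set J | invariant_ideal gr J], cancel (@psi S) (phi gr)}].
Proof.
move=> nearS; have grS : is_graded gr := nearS.1.
have phiK : {in [set I | graded_ideal gr I], cancel (phi gr) (@psi S)}.
  by move=> I /set_mem; exact: psi_phi.
have psiK : {in [set J | invariant_ideal gr J], cancel (@psi S) (phi gr)}.
  move=> J /set_mem invJ; rewrite eqEsubset.
  by split; [exact: phi_psi_sub | exact: sub_phi_psi].
have psi_fun J : invariant_ideal gr J -> graded_ideal gr (psi J).
  exact: psi_graded_ideal.
split=> //; split.
- by move=> I; exact: phi_invariant_ideal.
- exact: can_in_inj phiK.
- move=> J invJ; exists (psi J); first exact: psi_fun.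
  by apply: psiK; exact: mem_set.
Qed.
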